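(* Let $\mathcal{H}$ be a real Hilbert space, $C\subset\mathcal{H}$ a nonempty closed convex set, $N\ge1$, and let $T^{(j)}:C\to C$, $1\le j\le N$, be nonexpansive mappings such that $F=\bigcap_{1\le j\le N}\mathrm{Fix}(T^{(j)})$ is nonempty. Let $0<a<b<1$ and let $(\alpha^{(j)}_n)_{n\ge0}$, $1\le j\le N$, be real sequences with $\alpha^{(j)}_n\in(a,b)$ for $2\le j\le N$ and all $n$, and $\alpha^{(1)}_n\in[0,b)$ for all $n$. Define $\Gamma^{(N+1)}_nx=x$ and, for $j=N,\dots,1$, $\Gamma^{(j)}_nx=\alpha^{(j)}_nx+(1-\alpha^{(j)}_n)T^{(j)}\Gamma^{(j+1)}_nx$ for $x\in C$, and put $R_n=\Gamma^{(1)}_n$. Then the sequence $(R_n)_{n\ge0}$ satisfies the NST-condition (I) with the family $\mathcal{F}=\{T^{(j)}:1\le j\le N\}$, and the sequence $(T_n)_{n\ge0}$ given by $T_n=(R_n+\mathrm{Id})/2$ is a $\mathcal{T}_C$-class and coherent sequence.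
   Context: $\mathrm{Fix}(T)=\{x\in C:Tx=x\}$. A mapping $T:C\to C$ is nonexpansive if $\|Tx-Ty\|\le\|x-y\|$ for all $x,y\in C$. NST-condition (I): let $(S_n)_{n\ge0}$ and $\mathcal{F}$ be two families of nonexpansive mappings of $C$ into itself such that $\emptyset\ne\mathrm{Fix}(\mathcal{F})=\bigcap_{n}\mathrm{Fix}(S_n)$, where $\mathrm{Fix}(\mathcal{F})$ is the set of common fixed points of the mappings in $\mathcal{F}$. Then $(S_n)$ satisfies the NST-condition (I) with $\mathcal{F}$ if for each bounded sequence $(z_n)$ in $C$, $\lim_n\|z_n-S_nz_n\|=0$ implies $\lim_n\|z_n-Tz_n\|=0$ for all $T\in\mathcal{F}$. $\mathcal{T}_C$-class: with $H(x,y)=\{z\in\mathcal{H}:\langle z-y,x-y\rangle\le0\}$, $\mathcal{T}_C$ is the set of mappings $T:C\to C$ such that $\mathrm{Fix}(T)\subset H(x,Tx)$ for all $x\in C$; a sequence is of $\mathcal{T}_C$-class if all its terms are in $\mathcal{T}_C$. Coherence: a sequence $(T_n)_{n\ge0}$ in $\mathcal{T}_C$ is coherent if for every bounded sequence $(z_n)_{n\ge0}$ in $C$ with $\sum_{n\ge0}\|z_{n+1}-z_n\|^2<\infty$ and $\sum_{n\ge0}\|z_n-T_nz_n\|^2<\infty$, every weak cluster point of $(z_n)$ belongs to $\bigcap_{n\ge0}\mathrm{Fix}(T_n)$. *)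

(* Defs.v *)
From HB Require Import structures.
From mathcomp Require Import all_boot all_order all_algebra.
From mathcomp Require Import all_classical all_reals all_analysis.

Set Implicit Arguments.
Unset Strict Implicit.
Unset Printing Implicit Defensive.

Import Order.TTheory GRing.Theory Num.Theory.
Import numFieldNormedType.Exports.

Local Open Scope classical_set_scope.
Local Open Scope ring_scope.

(* A real Hilbert space: a complete normed module whose norm comes from an
   inner product, i.e. a symmetric positive definite bilinear form. *)
HB.mixin Record CompleteNormedModule_isHilbert (R : realType) H
    & CompleteNormedModule R H := {
  inner : {dot H for @idfun R} ;
  inner_normE : forall x : H, inner x x = `|x| ^+ 2
}.

#[short(type="hilbertType")]
HB.structure Definition Hilbert (R : realType) :=
  {H of CompleteNormedModule_isHilbert R H & CompleteNormedModule R H}.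

Definition dual (R : realType) (V : normedModType R) :=
  {f : {linear V -> R^o} | continuous f}.

(* The coarsest topology on V for which all elements of the dual are
   continuous. *)
Definition weak_topology (R : realType) (V : normedModType R) : Type :=
  sup_topology
    (fun f : dual V => Topological.on (initial_topology (sval f))).

Definition weak_cluster (R : realType) (V : normedModType R)
    (z : nat -> V) : set V :=
  cluster ((z : nat -> weak_topology V) @ \oo).

Section Mappings.
Variables (R : realType) (H : hilbertType R) (C : set H).

(* A mapping of C into itself is a total function on H preserving C; its values
   outside C are irrelevant. *)
Definition nonexpansive (T : H -> H) : Prop :=
  set_fun C C T /\ 1.-lipschitz_C T.

Definition Fix (T : H -> H) : set H := [set x | C x /\ T x = x].

Definition NST_I (S : nat -> H -> H) (F : set (H -> H)) : Prop :=
  [/\ forall n, nonexpansive (S n),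
      forall T, F T -> nonexpansive T,
      \bigcap_(T in F) Fix T !=set0,
      \bigcap_(T in F) Fix T = \bigcap_n Fix (S n) &
      forall z : nat -> H, (forall n, C (z n)) -> bounded_fun z ->
        `|z n - S n (z n)| @[n --> \oo] --> (0 : R) ->
        forall T, F T -> `|z n - T (z n)| @[n --> \oo] --> (0 : R)].

Definition halfspace (x y : H) : set H :=
  [set z | inner (z - y) (x - y) <= 0].

Definition class_T (T : H -> H) : Prop :=
  set_fun C C T /\ forall x, C x -> Fix T `<=` halfspace x (T x).

Definition coherent (T : nat -> H -> H) : Prop :=
  forall z : nat -> H, (forall n, C (z n)) -> bounded_fun z ->
    cvgn (series (fun n => `|z n.+1 - z n| ^+ 2)) ->
    cvgn (series (fun n => `|z n - T n (z n)| ^+ 2)) ->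
    weak_cluster z `<=` \bigcap_n Fix (T n).

End Mappings.

(* Gamma N T alpha j is the j-th mapping of the descending recursion started at
   Gamma N T alpha N.+1 = id, see Gamma_last and Gamma_step; T and alpha are
   only used at indices between j and N. *)
Definition Gamma (R : realType) (H : hilbertType R) (N : nat)
    (T : nat -> H -> H) (alpha : nat -> R) (j : nat) (x : H) : H :=
  foldr (fun i y => alpha i *: x + (1 - alpha i) *: T i y) x
    (index_iota j N.+1).

Lemma Gamma_last (R : realType) (H : hilbertType R) (N : nat)
    (T : nat -> H -> H) (alpha : nat -> R) (x : H) :
  Gamma N T alpha N.+1 x = x.
Proof. by rewrite /Gamma /index_iota subnn. Qed.

Lemma Gamma_step (R : realType) (H : hilbertType R) (N : nat)
    (T : nat -> H -> H) (alpha : nat -> R) (j : nat) (x : H) : (j <= N)%N ->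
  Gamma N T alpha j x =
  alpha j *: x + (1 - alpha j) *: T j (Gamma N T alpha j.+1 x).
Proof. by move=> jN; rewrite /Gamma /index_iota subSn. Qed.

(* Main.v *)
(* For z in C, p a common fixed point and y_j = Gamma_j z, the gaps
   |z - p|^2 - |y_j - p|^2 satisfy, by the parallelogram-type identity for
   convex combinations,
     gap_j >= (1 - alpha_j) gap_(j+1)
              + alpha_j (1 - alpha_j) |z - T_j y_(j+1)|^2,
   while gap_1 <= 2 |z - p| |z - R z|.  Going up from j = 1 this bounds every
   |z - T_j y_(j+1)|^2, hence |z - T_j z|^2, by a constant multiple, uniform in
   n and z, of |z - p| |z - R_n z|.  This gives both Fix (R_n) = F and the
   NST-condition (I).  Coherence then follows from the weak closedness of C and
   the demiclosedness of Id - T_j at 0. *)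
From HB Require Import structures.
Require Import Defs.
From mathcomp Require Import all_boot all_order all_algebra.
From mathcomp Require Import all_classical all_reals all_analysis.
From mathcomp Require Import ring lra.
Import Order.TTheory GRing.Theory Num.Theory.
Import numFieldNormedType.Exports.
Local Open Scope classical_set_scope.
Local Open Scope ring_scope.

(** * Inner product identities, and weak cluster points tested by inner products *)

Section InnerProduct.
Context {R : realType} {H : hilbertType R}.
Implicit Types x y z u : H.

Lemma innerC x y : inner x y = inner y x.
Proof. by rewrite hermC expr0 mul1r. Qed.

Lemma innerDl x y z : inner (x + y) z = inner x z + inner y z.
Proof. exact: linearDl. Qed.

Lemma innerDr x y z : inner x (y + z) = inner x y + inner x z.
Proof. exact: linearDr. Qed.

Lemma innerNl x y : inner (- x) y = - inner x y.
Proof. exact: linearNl. Qed.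

Lemma innerNr x y : inner x (- y) = - inner x y.
Proof. exact: linearNr. Qed.

Lemma innerZl (c : R) x y : inner (c *: x) y = c * inner x y.
Proof. exact: linearZl_LR. Qed.

Lemma innerZr (c : R) x y : inner x (c *: y) = c * inner x y.
Proof. exact: linearZr_LR. Qed.

Lemma normD_sqr x y : `|x + y| ^+ 2 = `|x| ^+ 2 + `|y| ^+ 2 + 2 * inner x y.
Proof.
by rewrite -!inner_normE innerDl !innerDr (innerC y x); ring.
Qed.

Lemma normB_sqr x y : `|x - y| ^+ 2 = `|x| ^+ 2 + `|y| ^+ 2 - 2 * inner x y.
Proof. by rewrite normD_sqr normrN innerNr; ring. Qed.

(** The negative last term is what later controls the distances from [z] to [T j (G j.+1 z)]. *)
Lemma norm_conv_sqr (t : R) x y :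
  `|t *: x + (1 - t) *: y| ^+ 2 =
  t * `|x| ^+ 2 + (1 - t) * `|y| ^+ 2 - t * (1 - t) * `|x - y| ^+ 2.
Proof.
rewrite normB_sqr normD_sqr !normrZ innerZl innerZr !exprMn.
by rewrite !real_normK ?num_real//=; ring.
Qed.

(** Here Cauchy-Schwarz comes from the triangle inequality: square it and expand both sides. *)
Lemma inner_le x y : inner x y <= `|x| * `|y|.
Proof.
have : `|x + y| ^+ 2 <= (`|x| + `|y|) ^+ 2.
  by rewrite ler_sqr ?nnegrE ?addr_ge0// ler_normD.
by rewrite normD_sqr sqrrD; lra.
Qed.

Lemma norm_inner_le x y : `|inner x y| <= `|x| * `|y|.
Proof.
by rewrite ler_norml inner_le andbT lerNl -innerNl -(normrN x) inner_le.
Qed.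

Lemma inner_linear u : linear (fun x => inner u x : R^o).
Proof. by move=> k x y; rewrite innerDr innerZr. Qed.

Lemma inner_continuous u : continuous (fun x => inner u x : R^o).
Proof.
move=> x; apply/cvgrPdist_lt => e e0.
have u1 : 0 < `|u| + 1 by rewrite ltr_wpDl.
near=> y; rewrite -innerNr -innerDr.
apply: (le_lt_trans (norm_inner_le _ _)).
apply: (@le_lt_trans _ _ ((`|u| + 1) * `|x - y|)).
  by rewrite ler_wpM2r// lerDl.
rewrite mulrC -ltr_pdivlMr//; near: y.
by apply: cvgr_dist_lt; [exact: cvg_id | rewrite divr_gt0].
Unshelve. all: by end_near. Qed.

Definition inner_dual u : dual H :=
  exist _ (HB.pack_for {linear H -> R^o} (fun x : H => inner u x : R^o)
    (GRing.isLinear.Build _ _ _ _ _ (inner_linear u))) (inner_continuous u).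

(** The strip of all [y] with [|inner u (y - x)| < e] is a weak neighbourhood of [x], so it meets
    every tail of [z]. One functional at a time suffices for both weak arguments below. *)
Lemma weak_cluster_inner (z : nat -> H) (x u : H) (P : nat -> Prop) (e : R) :
  weak_cluster z x -> 0 < e -> (\forall n \near \oo, P n) ->
  exists n, P n /\ `|inner u (z n - x)| < e.
Proof.
move=> zx e0 [n0 _ nP].
pose B : set (weak_topology H) := [set y | `|inner u (y - x)| < e].
have Bx : nbhs (x : weak_topology H) B.
  (* The weak topology is finer than the initial topology of the single functional [inner_dual u],
     where the strip is the preimage of a ball. *)
  have /cvg_sup/(_ (inner_dual u)) := @cvg_id _ (nbhs (x : weak_topology H)).
  move=> xcvg; suff : nbhs (x : initial_topology (sval (inner_dual u))) B.
    exact: xcvg.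
  have := @initial_continuous H R^o (sval (inner_dual u)) x
    [set r | `|r - inner u x| < e].
  have -> : B = sval (inner_dual u) @^-1` [set r | `|r - inner u x| < e].
    by rewrite predeqE => y; rewrite /B/= innerDr innerNr.
  apply; apply/nbhs_ballP; exists e => //= r.
  by rewrite /ball/= distrC.
have [|y [[n n0n <-] By]] := zx (z @` [set n | n0 <= n]%N) B _ Bx.
  by exists n0 => // n /= n0n; exists n.
by exists n; split => //; exact: nP.
Qed.

End InnerProduct.

Lemma convex_setP {R : realType} {H : hilbertType R} (C : set H) (t : R) x y :
  convex_set C -> 0 <= t <= 1 -> C x -> C y -> C (t *: x + (1 - t) *: y).
Proof.
move=> Cconvex t01 Cx Cy.
have := Cconvex x y (Itv01 (andP t01).1 (andP t01).2).
by rewrite !inE; apply.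
Qed.

Lemma bounded_fun_dist {R : realType} {H : hilbertType R} (z : nat -> H) x :
  bounded_fun z -> exists B : R, forall n, `|z n - x| <= B.
Proof.
move=> [M [_ zM]]; exists (M + 1 + `|x|) => n.
rewrite (le_trans (ler_normB _ _))// lerD2r.
by apply: (zM (M + 1)); rewrite ?ltrDl.
Qed.

(** * Weak cluster points of bounded sequences in a closed convex set *)

Section WeakClosure.
Context {R : realType} {H : hilbertType R}.
Variables (C : set H) (Cclosed : closed C) (Cconvex : convex_set C).

(* An almost nearest point c replaces the metric projection of x onto C, so
   that completeness is not needed. *)
Lemma almost_projection (x : H) : C !=set0 -> ~ C x ->
  exists D : R, 0 < D /\ forall B : R, exists c : H,
    [/\ C c, D <= `|x - c| ^+ 2 &
      forall y, C y -> `|y - x| <= B -> inner (x - c) (y - c) <= D / 2].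
Proof.
move=> [c0 Cc0] nCx.
pose E := [set `|x - c| ^+ 2 | c in C].
have lbE : lbound E 0 by move=> _ [c _ <-]; rewrite sqr_ge0.
have E_inf : has_inf E by split; [exists (`|x - c0| ^+ 2), c0 | exists 0].
have D_le c : C c -> inf E <= `|x - c| ^+ 2.
  by move=> Cc; apply: ge_inf; [exists 0 | exists c].
have D0 : 0 < inf E.
  have /closed_openC := Cclosed.
  rewrite openE => /(_ x nCx) /nbhs_ballP[r/= r0 rC].
  apply: (@lt_le_trans _ _ (r ^+ 2)); first by rewrite exprn_gt0.
  apply: lb_le_inf => [|_ [c Cc <-]]; first by exists (`|x - c0| ^+ 2), c0.
  rewrite ler_sqr ?nnegrE ?(ltW r0)// leNgt; apply/negP => xc.
  by have := rC c; rewrite -ball_normE => /(_ xc); apply.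
move: (inf E) D0 D_le (@inf_adherent R E) => D D0 D_le adh.
exists D; split => // B.
(* By the parallelogram law [Q] bounds [|y - c| ^+ 2] once [|x - c| ^+ 2 < D + 1]; the step length
   [t] is chosen so that [t * Q = D / 2]. *)
pose Q := 2 * B ^+ 2 + 2 * (D + 1).
have Q0 : 2 * D < Q by rewrite /Q; have := sqr_ge0 B; lra.
pose t := D / (2 * Q).
have t0 : 0 < t by rewrite divr_gt0//; lra.
have t1 : t <= 1 by rewrite ler_pdivrMr; lra.
have tQ : t * Q = D / 2 by rewrite /t; field; apply/eqP; lra.
have e0 : 0 < Num.min 1 (t * D / 2) by rewrite lt_min ltr01/=; nra.
have [_ [c Cc <-]] := adh _ e0 E_inf.
rewrite -ltrBlDl lt_min => /andP[xc1 xct].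
exists c; split => [||y Cy yxB]; [by []|exact: D_le|].
have yc : `|y - c| ^+ 2 <= Q.
  have -> : y - c = (y - x) + (x - c) by rewrite addrA subrK.
  have := sqr_ge0 `|(y - x) - (x - c)|.
  have yxB2 : `|y - x| ^+ 2 <= B ^+ 2.
    by rewrite ler_pXn2r// nnegrE// (le_trans _ yxB).
  rewrite (normB_sqr (y - x)) (normD_sqr (y - x)) /Q; lra.
(* Moving from [c] towards [y] by [t] cannot bring the squared distance to [x] below [D]. Expanding
   and dividing by [2 * t], the defect [t * D / 2] of [c] and the quadratic term contribute at most
   [D / 4] each. *)
have := D_le _ (convex_setP C t y c Cconvex _ Cy Cc).
rewrite (ltW t0) t1 => /(_ isT).
have -> : x - (t *: y + (1 - t) *: c) = (x - c) - t *: (y - c).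
  rewrite scalerBr scalerBl scale1r opprB opprD opprB.
  by rewrite (addrC (- (t *: y))) (addrC (t *: c) (- c)) !addrA.
rewrite (normB_sqr (x - c)) innerZr normrZ (gtr0_norm t0) exprMn => Dle.
have : t * `|y - c| ^+ 2 <= D / 2 by rewrite -tQ ler_pM2l.
rewrite -(ler_pM2l t0) -(ler_pM2l t0 _ (D / 2)) => tv.
lra.
Qed.

(** If [x] were outside [C], [inner (x - c) (z n - c)] would be at most [D / 2] for all [n]. But it
    equals [|x - c| ^+ 2 + inner (x - c) (z n - x)], which exceeds [D - D / 2] for some [n]. *)
Lemma weak_cluster_closed (z : nat -> H) (x : H) : (forall n, C (z n)) ->
  bounded_fun z -> weak_cluster z x -> C x.
Proof.
move=> Cz bz zx; apply: contrapT => nCx.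
have [|D [D0 proj]] := almost_projection x _ nCx; first by exists (z 0).
have [B zB] := bounded_fun_dist z x bz.
have [c [Cc Dc cz]] := proj B.
have [||n [_ ]] := weak_cluster_inner z x (x - c) xpredT (D / 2) zx.
- by rewrite divr_gt0.
- exact: nearW.
have := cz _ (Cz n) (zB n).
have -> : z n - c = (z n - x) + (x - c) by rewrite addrA subrK.
rewrite innerDr inner_normE ltr_norml => ? /andP[? _]; lra.
Qed.

End WeakClosure.

(** * Demiclosedness at 0 of [Id - T] for nonexpansive [T] *)

Section Nonexpansive.
Context {R : realType} {H : hilbertType R}.
Variable C : set H.

Lemma nonexpansive_le (T : H -> H) x y :
  nonexpansive C T -> C x -> C y -> `|T x - T y| <= `|x - y|.
Proof. by move=> [_ /(_ (x, y))/= Tlip] Cx Cy; rewrite -[leRHS]mul1r Tlip. Qed.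

(** Opial's argument: expanding [|z n - T x| ^+ 2] around [x] produces the extra term
    [d = |x - T x| ^+ 2] and a small inner product, whereas nonexpansiveness keeps [|z n - T x|]
    close to or below [|z n - x|]. *)
Lemma demiclosed (T : H -> H) (z : nat -> H) (x : H) :
  nonexpansive C T -> (forall n, C (z n)) -> bounded_fun z -> C x ->
  `|z n - T (z n)| @[n --> \oo] --> (0 : R) -> weak_cluster z x -> T x = x.
Proof.
move=> Tne Cz bz Cx zT zx; apply/eqP; rewrite -subr_eq0 -normr_eq0 -sqrf_eq0.
rewrite distrC; apply: contrapT => /negP dn0.
have d0 : 0 < `|x - T x| ^+ 2 by rewrite lt_neqAle eq_sym dn0 sqr_ge0.
have [d dE] : exists d, `|x - T x| ^+ 2 = d by eexists.
rewrite dE in d0.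
have [B zB] := bounded_fun_dist z x bz.
have B0 : 0 <= B := le_trans (normr_ge0 _) (zB 0).
(* With [s = |z n - T (z n)| < e], the excess [s ^+ 2 + 2 * s * |z n - x|] is at most
   [s * (1 + 2 * B) < d / 4], while the weak test leaves at least [d / 2]. *)
pose e := Num.min 1 (d / (4 * (1 + 2 * B))).
have e0 : 0 < e by rewrite lt_min ltr01 divr_gt0//; lra.
have [|| n [zTe]] := weak_cluster_inner z x (x - T x)
  (fun n => `|z n - T (z n)| < e) (d / 4) zx.
- by rewrite divr_gt0.
- have /cvgrPdist_lt/(_ e e0) := zT.
  by apply: filterS => n; rewrite sub0r normrN normr_id.
have le_zTx : `|z n - T x| <= `|z n - T (z n)| + `|z n - x|.
  rewrite -[z n - T x](subrKA (T (z n))) (le_trans (ler_normD _ _))// lerD2l.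
  exact: nonexpansive_le.
have : `|z n - T x| ^+ 2 <= (`|z n - T (z n)| + `|z n - x|) ^+ 2.
  by rewrite ler_sqr ?nnegrE ?addr_ge0.
rewrite -{1}[z n - T x](subrKA x) (normD_sqr (z n - x)) dE sqrrD innerC.
rewrite ltr_norml => sqr_le /andP[inner_gt _].
move: zTe; rewrite lt_min ltr_pdivlMr; last by lra.
move=> /andP[e1 ed]; move: (zB n) => zBn.
have : `|z n - T (z n)| * `|z n - x| <= `|z n - T (z n)| * B.
  by rewrite ler_wpM2l.
have : `|z n - T (z n)| ^+ 2 <= `|z n - T (z n)|.
  by rewrite expr2 ler_piMl// ltW.
lra.
Qed.

End Nonexpansive.

(** * Invariance of [C], nonexpansiveness and fixed points of the maps [Gamma] *)

Section GammaMaps.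
Context {R : realType} {H : hilbertType R}.
Variables (C : set H) (Cconvex : convex_set C) (N : nat) (T : nat -> H -> H).
Hypothesis Tne : forall j, (1 <= j <= N)%N -> nonexpansive C (T j).

(** Induction in the direction of the recursion for [Gamma], obtained from ordinary induction on
    [N.+1 - j]. *)
Lemma descending_ind (P : nat -> Prop) : P N.+1 ->
  (forall j, (1 <= j <= N)%N -> P j.+1 -> P j) ->
  forall j, (1 <= j <= N.+1)%N -> P j.
Proof.
move=> PN Pj j /andP[j1 jN]; rewrite -(subKn jN).
have : (N.+1 - j <= N)%N by rewrite leq_subLR -(prednK j1) addSn ltnS leq_addl.
elim: (N.+1 - j)%N => [|k IH] kN; first by rewrite subn0.
rewrite subSS; apply: Pj; first by rewrite subn_gt0 kN leq_subr.
by rewrite -subSn ?(ltnW kN)//; apply/IH/ltnW.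
Qed.

Section Relaxed.
Variable alpha : nat -> R.
Hypothesis alpha01 : forall j, (1 <= j <= N)%N -> 0 <= alpha j <= 1.
Local Notation G := (Gamma N T alpha).

Lemma Gamma_in j x : (1 <= j <= N.+1)%N -> C x -> C (G j x).
Proof.
move=> jN Cx; move: j jN; apply: descending_ind => [|j jN Cj].
  by rewrite Gamma_last.
rewrite (Gamma_step _ _ _ (andP jN).2); apply: convex_setP => //.
  exact: alpha01.
exact: (Tne _ jN).1.
Qed.

Lemma Gamma_nonexpansive j : (1 <= j <= N.+1)%N -> nonexpansive C (G j).
Proof.
move=> jN; split=> [x|[x y]/= [Cx Cy]]; first exact: Gamma_in.
rewrite mul1r; move: j jN; apply: descending_ind => [|j jN le_j].
  by rewrite !Gamma_last.
rewrite !(Gamma_step _ _ _ (andP jN).2).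
have /andP[al0 al1] := alpha01 _ jN.
rewrite opprD addrACA -!scalerBr (le_trans (ler_normD _ _))// !normrZ.
rewrite (ger0_norm al0) ger0_norm ?subr_ge0//.
have jN1 : (1 <= j.+1 <= N.+1)%N by case/andP: jN.
have le_T : `|T j (G j.+1 x) - T j (G j.+1 y)| <= `|x - y|.
  apply: le_trans le_j; apply: nonexpansive_le (Tne _ jN) _ _; exact: Gamma_in.
have : (1 - alpha j) * `|T j (G j.+1 x) - T j (G j.+1 y)| <=
       (1 - alpha j) * `|x - y| by rewrite ler_wpM2l// subr_ge0.
lra.
Qed.

Lemma Gamma_fixed j p : (forall i, (1 <= i <= N)%N -> T i p = p) ->
  (1 <= j <= N.+1)%N -> G j p = p.
Proof.
move=> Tp; move: j; apply: descending_ind => [|j jN Gp].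
  by rewrite Gamma_last.
by rewrite (Gamma_step _ _ _ (andP jN).2) Gp Tp// -scalerDl subrKC scale1r.
Qed.

End Relaxed.

End GammaMaps.

(** * Bounding [|z - T j z|] by [|z - p|] and [|z - G 1 z|] *)

Section Estimate.
Context {R : realType} {H : hilbertType R}.
Variables (C : set H) (Cconvex : convex_set C) (N : nat) (T : nat -> H -> H).
Hypothesis Tne : forall j, (1 <= j <= N)%N -> nonexpansive C (T j).
Variables (a b : R) (a0 : 0 < a) (ab : a < b) (b1 : b < 1) (alpha : nat -> R).
Hypothesis alphaj : forall j, (2 <= j <= N)%N -> alpha j \in `]a, b[.
Hypothesis alpha1 : alpha 1 \in `[0, b[.
Local Notation G := (Gamma N T alpha).

Lemma alpha_itv j : (1 <= j <= N)%N -> 0 <= alpha j < b.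
Proof.
case: j => [//|[_|j jN]]; first by move: alpha1; rewrite in_itv.
have := alphaj j.+2 jN; rewrite in_itv/= => /andP[? ->].
by rewrite (ltW (lt_trans a0 _)).
Qed.

Let alpha01 j : (1 <= j <= N)%N -> 0 <= alpha j <= 1.
Proof. by move=> /alpha_itv/andP[-> /ltW/le_trans->//]; exact: ltW. Qed.

Let onem_alpha_ge0 j : (1 <= j <= N)%N -> 0 <= 1 - alpha j.
Proof. by move=> /alpha01/andP[_]; rewrite subr_ge0. Qed.

Let onem_b_gt0 : 0 < 1 - b. Proof. by rewrite subr_gt0. Qed.

Let coef_ge0 : 0 <= a * (1 - b) ^+ N.+1.
Proof. by rewrite mulr_ge0 ?exprn_ge0// ltW. Qed.

Variables (p z : H).
Hypotheses (Cp : C p) (Tp : forall j, (1 <= j <= N)%N -> T j p = p) (Cz : C z).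

Let Gz j : (1 <= j <= N.+1)%N -> C (G j z).
Proof. by move=> jN; exact: (Gamma_in C Cconvex N T Tne alpha alpha01). Qed.

Lemma Gamma_dist_fixed j : (1 <= j <= N.+1)%N -> `|G j z - p| <= `|z - p|.
Proof.
move=> jN; rewrite -{1}(Gamma_fixed N T alpha _ p Tp jN).
apply: nonexpansive_le Cz Cp.
exact: (Gamma_nonexpansive C Cconvex N T Tne alpha alpha01).
Qed.

Let gap j : R := `|z - p| ^+ 2 - `|G j z - p| ^+ 2.
Let err j : R := `|z - T j (G j.+1 z)|.

Let err_ge0 j : 0 <= err j. Proof. exact: normr_ge0. Qed.

(** Factor the difference of squares: the difference of the norms is at most [|z - G 1 z|], and
    their sum at most [2 * |z - p|]. *)
Lemma gap1_le : gap 1 <= 2 * (`|z - p| * `|z - G 1 z|).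
Proof.
have le_p := Gamma_dist_fixed 1 isT.
have : `|z - p| <= `|z - G 1 z| + `|G 1 z - p|.
  by rewrite -{1}[z - p](subrKA (G 1 z)) ler_normD.
rewrite /gap subr_sqr => le_z.
have : (`|z - p| - `|G 1 z - p|) * (`|z - p| + `|G 1 z - p|) <=
       `|z - G 1 z| * (`|z - p| + `|z - p|).
  by apply: ler_pM; rewrite ?subr_ge0 ?addr_ge0// ?lerD2l// lerBlDr.
lra.
Qed.

(** Apply [norm_conv_sqr] to [z - p] and [T j y - p], then use [|T j y - p| <= |y - p|], valid
    because [T j] fixes [p]. *)
Lemma gap_step j : (1 <= j <= N)%N ->
  (1 - alpha j) * gap j.+1 + alpha j * (1 - alpha j) * err j ^+ 2 <= gap j.
Proof.
move=> jN; rewrite /gap (Gamma_step _ _ _ (andP jN).2).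
set y := G j.+1 z.
have -> : alpha j *: z + (1 - alpha j) *: T j y - p =
          alpha j *: (z - p) + (1 - alpha j) *: (T j y - p).
  by rewrite !scalerBr addrACA -opprD -scalerDl subrKC scale1r.
rewrite norm_conv_sqr (_ : z - p - _ = z - T j y); last first.
  by rewrite opprB subrKA.
have jN1 : (1 <= j.+1 <= N.+1)%N by case/andP: jN.
have le_T : `|T j y - p| ^+ 2 <= `|y - p| ^+ 2.
  rewrite ler_sqr ?nnegrE// -{1}(Tp _ jN).
  by apply: nonexpansive_le (Tne _ jN) _ _ => //; exact: Gz.
have := ler_wpM2l (onem_alpha_ge0 _ jN) le_T.
rewrite /err -/y; lra.
Qed.

Let w : R := `|z - p| * `|z - G 1 z|.

(** Each step up drops the nonnegative error term of [gap_step] and costs one factor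
    [1 - b <= 1 - alpha j.+1]. *)
Lemma gap_le j : (j <= N)%N -> (1 - b) ^+ j * gap j.+1 <= 2 * w.
Proof.
elim: j => [_|j IH jN]; first by rewrite expr0 mul1r gap1_le.
apply: le_trans (IH (ltnW jN)); rewrite exprSr -mulrA ler_wpM2l//.
  by rewrite exprn_ge0// ltW.
have jN1 : (1 <= j.+1 <= N)%N by rewrite jN.
have := gap_step _ jN1; have /andP[al0 alb] := alpha_itv _ jN1.
have gap0 : 0 <= gap j.+2.
  by rewrite subr_ge0 ler_sqr ?nnegrE//; apply: Gamma_dist_fixed.
have : 0 <= (b - alpha j.+1) * gap j.+2 by rewrite mulr_ge0// subr_ge0 ltW.
have : 0 <= alpha j.+1 * (1 - alpha j.+1) * err j.+1 ^+ 2.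
  by rewrite mulr_ge0 ?sqr_ge0// mulr_ge0// onem_alpha_ge0.
lra.
Qed.

Lemma dist_Gamma j : (1 <= j <= N)%N ->
  `|z - G j z| = (1 - alpha j) * err j.
Proof.
move=> jN; rewrite (Gamma_step _ _ _ (andP jN).2).
rewrite -[1 - _ in RHS]ger0_norm ?onem_alpha_ge0// -normrZ scalerBr.
by rewrite [in RHS]scalerBl scale1r opprD addrA.
Qed.

Lemma err_le j : (1 <= j <= N)%N ->
  a * (1 - b) ^+ N.+1 * err j ^+ 2 <= 2 * w.
Proof.
case: j => [//|j] jN; have /andP[al0 alb] := alpha_itv _ jN.
have onem_b_le1 : 1 - b <= 1 by rewrite gerBl (le_trans al0)// ltW.
have expb_le k : (k <= N)%N -> (1 - b) ^+ N <= (1 - b) ^+ k.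
  by move=> kN; rewrite ler_wiXn2l// ltW.
(* [alpha 1] may vanish, and with it the error term of [gap_step]. Index 1 is therefore read off
   [|z - G 1 z| = (1 - alpha 1) * err 1], together with [|z - G 1 z| <= 2 * |z - p|]. *)
case: j jN al0 alb => [|j] jN al0 alb.
  have e_le : (1 - b) * err 1 <= `|z - G 1 z|.
    by rewrite dist_Gamma// ler_wpM2r ?err_ge0// lerD2l lerN2 ltW.
  have N1 : (1 <= N)%N by [].
  have w_le : `|z - G 1 z| ^+ 2 <= 2 * w.
    have : `|z - G 1 z| <= `|z - p| + `|p - G 1 z|.
      by rewrite -{1}[z - G 1 z](subrKA p) ler_normD.
    rewrite [`|p - _|]distrC; have := Gamma_dist_fixed 1 isT => le1 le2.
    rewrite expr2 /w mulrA [leRHS]mulrC ler_wpM2l//; lra.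
  apply: le_trans w_le.
  apply: (@le_trans _ _ (((1 - b) * err 1) ^+ 2)); last first.
    by rewrite ler_sqr ?nnegrE// mulr_ge0 ?err_ge0// ltW.
  rewrite exprMn ler_wpM2r ?sqr_ge0// exprS mulrA expr2.
  have := expb_le 1 N1; rewrite expr1; apply: ler_pM.
  - by rewrite mulr_ge0// ltW.
  - by rewrite exprn_ge0// ltW.
  - by rewrite ler_piMl ?ltW// (lt_trans ab).
(* For the remaining indices [alpha j.+2 > a], so [gap j.+2] dominates
   [a * (1 - b) * err j.+2 ^+ 2]. The powers of [1 - b] are then lowered to the common exponent
   [N.+1]. *)
apply: le_trans (gap_le j.+1 _); last exact: ltnW.
have := gap_step _ jN.
have gap0 : 0 <= gap j.+3.
  by rewrite subr_ge0 ler_sqr ?nnegrE//; apply: Gamma_dist_fixed.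
have : 0 <= (1 - alpha j.+2) * gap j.+3 by rewrite mulr_ge0// onem_alpha_ge0.
have aj := alphaj j.+2 jN; move: aj; rewrite in_itv/= => /andP[aa _].
have : a * (1 - b) * err j.+2 ^+ 2 <=
       alpha j.+2 * (1 - alpha j.+2) * err j.+2 ^+ 2.
  rewrite ler_wpM2r ?sqr_ge0//; apply: ler_pM => //; try exact: ltW.
  by rewrite lerD2l lerN2 ltW.
move=> le1 le2 le3.
have {le1 le2 le3} le_gap : a * (1 - b) * err j.+2 ^+ 2 <= gap j.+2 by lra.
apply: (@le_trans _ _ ((1 - b) ^+ j.+1 * (a * (1 - b) * err j.+2 ^+ 2))).
  rewrite [leRHS]mulrA ler_wpM2r ?sqr_ge0// exprSr [leRHS]mulrCA.
  by rewrite ler_wpM2l ?(ltW a0)// ler_wpM2r ?(ltW onem_b_gt0)// expb_le// ltnW.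
by rewrite ler_wpM2l ?exprn_ge0// ?(ltW onem_b_gt0).
Qed.

Lemma dist_Gamma_le j : (1 <= j <= N.+1)%N ->
  a * (1 - b) ^+ N.+1 * `|z - G j z| ^+ 2 <= 2 * w.
Proof.
move=> /andP[j1]; rewrite leq_eqVlt => /orP[/eqP->|jN].
  by rewrite Gamma_last subrr normr0 expr0n/= mulr0 !mulr_ge0.
have {}jN : (1 <= j <= N)%N by rewrite j1.
apply: le_trans (err_le _ jN); rewrite ler_wpM2l//.
rewrite ler_sqr ?nnegrE ?err_ge0// dist_Gamma// ler_piMl ?err_ge0//.
by rewrite gerBl; case/andP: (alpha01 _ jN).
Qed.

(** Insert [T j (G j.+1 z)]: the second piece is at most [|z - G j.+1 z|] by nonexpansiveness.
    Squaring the sum doubles two bounds of [2 * w], whence 8. *)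
Lemma dist_T_le j : (1 <= j <= N)%N ->
  a * (1 - b) ^+ N.+1 * `|z - T j z| ^+ 2 <= 8 * w.
Proof.
move=> jN; have jN1 : (1 <= j.+1 <= N.+1)%N by case/andP: jN.
have le_sum : `|z - T j z| <= err j + `|z - G j.+1 z|.
  rewrite -[z - T j z](subrKA (T j (G j.+1 z))) (le_trans (ler_normD _ _))//.
  rewrite lerD2l [leRHS]distrC; apply: nonexpansive_le (Tne _ jN) _ _ => //.
  exact: Gz.
have sq_le : `|z - T j z| ^+ 2 <= 2 * err j ^+ 2 + 2 * `|z - G j.+1 z| ^+ 2.
  have : `|z - T j z| ^+ 2 <= (err j + `|z - G j.+1 z|) ^+ 2.
    by rewrite ler_sqr ?nnegrE ?addr_ge0 ?err_ge0.
  by have := sqr_ge0 (err j - `|z - G j.+1 z|); rewrite sqrrB sqrrD; lra.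
have := err_le _ jN; have := dist_Gamma_le _ jN1.
have := ler_wpM2l coef_ge0 sq_le; lra.
Qed.

End Estimate.

(** * The averaged maps [(S + Id) / 2] *)

Section Averages.
Context {R : realType} {H : hilbertType R}.
Variable C : set H.

Lemma sub_average (S : H -> H) (x : H) :
  x - 2^-1 *: (S x + x) = 2^-1 *: (x - S x).
Proof.
rewrite scalerDr scalerBr (addrC (2^-1 *: S x)) opprD addrA; congr (_ - _).
by rewrite -{1}[x]scale1r -scalerBl; congr (_ *: _); field.
Qed.

Lemma Fix_average (S : H -> H) : Fix C (fun x => 2^-1 *: (S x + x)) = Fix C S.
Proof.
rewrite predeqE => x; split=> -[Cx Ex]; split=> //; last first.
  by apply/esym/subr0_eq; rewrite sub_average Ex subrr scaler0.
have /esym/eqP := sub_average S x; rewrite Ex subrr scaler_eq0 invr_eq0.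
by rewrite pnatr_eq0/= subr_eq0 => /eqP/esym.
Qed.

(** With [u = x - p] and [v = S x - p], the inner product defining the half-space equals
    [(|v| ^+ 2 - |u| ^+ 2) / 4]. *)
Lemma class_T_average (S : H -> H) : convex_set C -> nonexpansive C S ->
  class_T C (fun x => 2^-1 *: (S x + x)).
Proof.
move=> Cconvex Sne; split=> [x Cx|x Cx p].
  have half : 1 - 2^-1 = 2^-1 :> R by field.
  rewrite scalerDr -{2}half; apply: convex_setP => //; last exact: Sne.1.
  by rewrite invr_ge0 ler0n invf_le1// ler1n.
rewrite Fix_average => -[Cp Sp]; rewrite /halfspace/= sub_average innerZr.
have le_p : `|S x - p| ^+ 2 <= `|x - p| ^+ 2.
  by rewrite ler_sqr ?nnegrE// -{1}Sp; exact: nonexpansive_le Sne Cx Cp.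
have -> : p - 2^-1 *: (S x + x) = - (2^-1 *: ((S x - p) + (x - p))).
  rewrite addrACA -opprD scalerBr opprB -mulr2n -(scaler_nat 2 p) scalerA.
  by rewrite mulVf ?pnatr_eq0// scale1r.
have -> : x - S x = (x - p) - (S x - p) by rewrite opprB subrKA.
move: (S x - p) (x - p) le_p => v u.
rewrite innerNl innerZl innerDl !innerDr !innerNr !inner_normE (innerC u v).
lra.
Qed.

End Averages.

(** * Passage to the limit and conclusion *)

Lemma sqr_cvg0 {R : realType} (u : nat -> R) : (forall n, 0 <= u n) ->
  u n ^+ 2 @[n --> \oo] --> 0 -> u n @[n --> \oo] --> 0.
Proof.
move=> u0 /(continuous_cvg _ (@sqrt_continuous R 0)); rewrite sqrtr0.
apply: cvg_trans; apply: near_eq_cvg; apply: nearW => n /=.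
by rewrite sqrtr_sqr ger0_norm.
Qed.

Theorem proposition15 (R : realType) (H : hilbertType R) (C : set H)
    (C0 : C !=set0) (Cclosed : closed C) (Cconvex : convex_set C)
    (N : nat) (N1 : (1 <= N)%N) (T : nat -> H -> H)
    (Tne : forall j, (1 <= j <= N)%N -> nonexpansive C (T j))
    (F0 : \bigcap_(j in [set j | (1 <= j <= N)%N]) Fix C (T j) !=set0)
    (a b : R) (a0 : 0 < a) (ab : a < b) (b1 : b < 1)
    (alpha : nat -> nat -> R)
    (alphaj : forall j n, (2 <= j <= N)%N -> alpha j n \in `]a, b[)
    (alpha1 : forall n, alpha 1%N n \in `[0, b[) :
  let R_ := fun (n : nat) (x : H) => Gamma N T (alpha ^~ n) 1 x in
  let T_ := fun (n : nat) (x : H) => 2^-1 *: (R_ n x + x) in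
  NST_I C R_ [set T j | j in [set j | (1 <= j <= N)%N]] /\
  (forall n, class_T C (T_ n)) /\ coherent C T_.
Proof.
move=> R_ T_.
have alpha01 n j : (1 <= j <= N)%N -> 0 <= alpha j n <= 1.
  move=> jN; have /andP[-> /ltW/le_trans->//] :=
    alpha_itv N a b a0 (alpha ^~ n) (fun i => alphaj i n) (alpha1 n) j jN.
  exact: ltW.
have R_ne n : nonexpansive C (R_ n).
  exact: (Gamma_nonexpansive C Cconvex N T Tne _ (alpha01 n)).
have [p Fp] := F0.
have Cp : C p by have [] := Fp 1 N1.
have Tp j : (1 <= j <= N)%N -> T j p = p by move=> jN; have [] := Fp j jN.
(* [K] involves only [a], [b] and [N], so the estimate is uniform in [n]; this is what lets [n] vary
   along the sequence. *)
pose K := a * (1 - b) ^+ N.+1.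
have K0 : 0 < K by rewrite mulr_gt0 ?exprn_gt0// subr_gt0.
have dist_T n z j : C z -> (1 <= j <= N)%N ->
    `|z - T j z| ^+ 2 <= K^-1 * 8 * (`|z - p| * `|z - R_ n z|).
  move=> Cz jN; rewrite -mulrA ler_pdivlMl//.
  exact: (dist_T_le C Cconvex N T Tne a b a0 ab b1 (alpha ^~ n)
    (fun i => alphaj i n) (alpha1 n)).
(* A fixed point of [R_ n] makes the right-hand side of [dist_T] vanish; the converse is
   [Gamma_fixed]. *)
have Fix_R n :
    Fix C (R_ n) = \bigcap_(j in [set j | (1 <= j <= N)%N]) Fix C (T j).
  apply/seteqP; split=> [x [Cx Rx] j /= jN|x Fx].
    split=> //; apply/eqP; rewrite eq_sym -subr_eq0 -normr_eq0 -sqrf_eq0.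
    rewrite eq_le sqr_ge0 andbT (le_trans (dist_T n x j Cx jN))//.
    by rewrite Rx subrr normr0 !mulr0.
  split; first by have [] := Fx 1 N1.
  apply: (Gamma_fixed N T _ 1) => //= j jN; by have [] := Fx j jN.
have cvg_T z : (forall n, C (z n)) -> bounded_fun z ->
    `|z n - R_ n (z n)| @[n --> \oo] --> (0 : R) ->
    forall j, (1 <= j <= N)%N -> `|z n - T j (z n)| @[n --> \oo] --> (0 : R).
  move=> Cz bz zR j jN; have [B zB] := bounded_fun_dist z p bz.
  apply: sqr_cvg0 => //.
  apply: (@squeeze_cvgr _ _ _ _ (fun=> 0)
    (fun n => K^-1 * 8 * B * `|z n - R_ n (z n)|)).
  - apply: nearW => n; rewrite sqr_ge0/= (le_trans (dist_T n _ j _ jN))//.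
    rewrite -[leRHS]mulrA ler_wpM2l ?ler_wpM2r//.
    by rewrite mulr_ge0// invr_ge0 ltW.
  - exact: cvg_cst.
  - by rewrite -[X in _ --> X](mulr0 (K^-1 * 8 * B)); exact: cvgMr.
split; [split|split].
- by [].
- by move=> _ [j jN <-]; exact: Tne.
- by rewrite bigcap_image.
- rewrite bigcap_image.
  under [RHS]eq_bigcapr do rewrite Fix_R.
  by rewrite bigcap_const//; exists 0.
- by move=> z Cz bz zR _ [j jN <-]; exact: cvg_T.
- by move=> n; exact: class_T_average.
- move=> z Cz bz _ zT x zx n _; rewrite /T_ Fix_average Fix_R => j /= jN.
  have Cx := weak_cluster_closed C Cclosed Cconvex z x Cz bz zx.
  split=> //; apply: (demiclosed C (T j) z x) => //; first exact: Tne.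
  apply: cvg_T => //.
  (* Summability forces [|z n - T_ n (z n)|] to 0, and [|z n - R_ n (z n)|] is exactly twice this
     distance. *)
  have := cvg_series_cvg_0 zT => /sqr_cvg0 zT0.
  have -> : (fun n => `|z n - R_ n (z n)|) = (fun n => 2 * `|z n - T_ n (z n)|).
    rewrite funeqE => k; rewrite /T_ sub_average normrZ ger0_norm ?invr_ge0//.
    by rewrite mulVKf.
  by rewrite -[X in _ --> X](mulr0 2); apply: cvgMr; exact: zT0.
Qed.
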